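(* Let $k\ge 1$ be an integer. For $1\le n\le k+2$, $|\mathcal I_{k,n}| = 1$. For every integer $n\ge k+3$, $$|\mathcal I_{k,n}| = |\mathcal I_{k,n-1}|+|\mathcal I_{k,n-k-2}|.$$
   Context: $\mathbb N=\{1,2,3,\dots\}$, $[n]=\{1,2,\dots,n\}$, and $[a,b]$ is the set of all integers between $a$ and $b$ inclusive. A finite nonempty set $F\subset\mathbb N$ is called Schreier if $\min F\ge |F|$. For $k\in\mathbb N$, a nonempty set $D\subset\mathbb N$ is called $k$-isolated if for every $a\in D$, $([a-k,a-1]\cup[a+1,a+k])\cap D=\emptyset$. For $k,n\in\mathbb N$, $\mathcal I_{k,n}:=\{F\subset[n] : n\in F,\ F\text{ is Schreier, and } F\text{ is } k\text{-isolated}\}$. *)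

(* Defs.v *)
From mathcomp Require Import all_boot.
From mathcomp Require Import finmap.

Set Implicit Arguments.
Unset Strict Implicit.
Unset Printing Implicit Defensive.

Local Open Scope fset_scope.

(* Sets of positive integers are encoded as finite sets of [nat]; membership  *)
(* of 0 is excluded by [F `<=` interval 1 n] in [isolated_schreier_sets].     *)

Definition interval (a b : nat) : {fset nat} := [fset x in index_iota a b.+1].

(* Equal to 0 on the empty set. *)
Definition minF (F : {fset nat}) : nat := head 0 (sort leq F).

Definition schreier (F : {fset nat}) : bool :=
  (F != fset0) && (#|` F| <= minF F).

(* [D] is meant to contain positive integers only. Both subtractions are      *)
(* truncated: [a - 1] is exact for [a >= 1], and for [a < k] the first        *)
(* interval stops at 0 instead of running over the negative integers, none of *)
(* which can belong to [D].                                                   *)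
Definition isolated (k : nat) (D : {fset nat}) : bool :=
  (D != fset0) &&
  all (fun a => (interval (a - k) (a - 1) `|` interval (a + 1) (a + k)) `&` D
                == fset0) D.

Definition isolated_schreier_sets (k n : nat) : {fset {fset nat}} :=
  [fset F in fpowerset (interval 1 n) | [&& n \in F, schreier F & isolated k F]].

(* Main.v *)
Require Import Defs.
From mathcomp Require Import all_boot.
From mathcomp Require Import finmap.
From mathcomp Require Import zify.

(** If [n - k - 1] is not in [F], moving the largest element [n] down to [n - 1]
    keeps [F] isolated and Schreier, and every isolated Schreier set with
    maximum [n - 1] arises so.  If [n - k - 1] is in [F], deleting [n] lowers the
    size by one, so the remaining set can be shifted down by one and stay
    Schreier; its maximum is then [n - k - 2]. *)

Local Open Scope fset_scope.
Local Open Scope nat_scope.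

Lemma in_interval (a b x : nat) : (x \in interval a b) = (a <= x <= b).
Proof. by rewrite inE /= mem_index_iota ltnS. Qed.

Lemma leq_minF (F : {fset nat}) (m : nat) :
  F != fset0 -> reflect {in F, forall x, m <= x} (m <= minF F).
Proof.
rewrite /minF => F0; have sF x : (x \in sort leq F) = (x \in F) by rewrite mem_sort.
have := sort_sorted leq_total F; move: sF.
case: (sort leq F) => [|y s] sF.
  by case/eqP: F0; apply/fsetP => x; rewrite -sF.
rewrite /= (path_sortedE leq_trans) => /andP[/allP ys _].
apply: (iffP idP) => [my x | mF]; last by apply: mF; rewrite -sF mem_head.
by rewrite -sF inE => /predU1P[-> // | /ys]; apply: leq_trans.
Qed.

(* [0] must be excluded: by truncation, [interval (0 - k) (0 - 1)] contains [0]. *)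
Lemma isolatedP (k : nat) (D : {fset nat}) :
  D != fset0 -> 0 \notin D ->
  reflect {in D &, forall x y, x < y -> x + k < y} (isolated k D).
Proof.
rewrite /isolated => -> D0; apply: (iffP allP) => [iso x y xD yD xy | iso a aD].
  rewrite ltnNge; apply/negP => yxk.
  have /eqP/fsetP/(_ y) := iso x xD.
  rewrite in_fsetI in_fsetU !in_interval yD in_fset0 andbT addn1 xy yxk.
  by rewrite orbT.
apply/eqP/fsetP => b; rewrite in_fsetI in_fsetU !in_interval in_fset0.
apply/negP => /andP[ab bD].
(* For positive [a], [a - 1 < a], so [b] differs from [a], and [iso], applied to the two in
   increasing order, gives a contradiction. *)
have a0 : a != 0 by apply: contraNneq D0 => <-.
have := iso a b aD bD; have := iso b a bD aD; lia.
Qed.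

(** Trades [minF] and the intervals for pointwise inequalities, which linear arithmetic can
    handle. *)
Lemma isolated_schreier_setsP (k n : nat) (F : {fset nat}) :
  reflect [/\ n \in F,
              {in F, forall x, 0 < x <= n},
              {in F, forall x, #|` F| <= x} &
              {in F &, forall x y, x < y -> x + k < y}]
          (F \in isolated_schreier_sets k n).
Proof.
rewrite /isolated_schreier_sets !inE /= fpowersetE.
have [nF | nF] := boolP (n \in F); last by rewrite andbF; right; case.
have F0 : F != fset0 by apply/fset0Pn; exists n.
rewrite /= /schreier F0 /=; apply: (iffP and3P).
  case=> /fsubsetP Fn /(leq_minF _ _ F0) Fs Fi.
  have Fn' : {in F, forall x, 0 < x <= n} by move=> x /Fn; rewrite in_interval.
  by split=> //; apply/isolatedP => //; apply/negP => /Fn'.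
case=> _ Fn /(leq_minF _ _ F0) Fs Fi; split=> //.
  by apply/fsubsetP => x /Fn; rewrite in_interval.
by apply/isolatedP => //; apply/negP => /Fn.
Qed.

(** A second element [x] would satisfy [x + k < n], hence [x <= 1], whereas a Schreier set with two
    elements has all of them at least 2. *)
Lemma isolated_schreier_sets_small (k n : nat) :
  0 < n <= k + 2 -> isolated_schreier_sets k n = [fset [fset n]].
Proof.
move=> nk; apply/fsetP => F; rewrite in_fset1.
apply/isolated_schreier_setsP/eqP => [[nF Fn Fs Fi] | ->].
  apply/fsetP => x; rewrite in_fset1; apply/idP/eqP => [xF | -> //].
  apply/eqP; apply/negPn/negP => xn.
  have Fx := Fn x xF; have Fxn := Fi x n xF nF.
  have : #|` [fset x; n]| <= #|` F|.
    by apply/fsubset_leq_card/fsubsetP => y; rewrite in_fset2 => /orP[] /eqP ->.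
  have := Fs x xF; rewrite cardfs2; lia.
split; rewrite ?in_fset1 //.
- by move=> x; rewrite in_fset1 => /eqP ->; lia.
- by move=> x; rewrite in_fset1 cardfs1 => /eqP ->; lia.
- by move=> x y; rewrite !in_fset1 => /eqP -> /eqP ->; lia.
Qed.

(** This map and [shift_add] invert the two moves described above, so that each of the two classes
    of sets becomes the image of an injective map. *)
Definition raise_max (m : nat) (G : {fset nat}) : {fset nat} := m.+1 |` (G `\ m).

Definition shift_add (n : nat) (G : {fset nat}) : {fset nat} :=
  n |` [fset x.+1 | x in G].

Lemma in_raise_max (m x : nat) (G : {fset nat}) :
  (x \in raise_max m G) = (x == m.+1) || (x != m) && (x \in G).
Proof. by rewrite in_fset1U in_fsetD1. Qed.

Lemma in_succ_fset (x : nat) (G : {fset nat}) :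
  (x \in [fset y.+1 | y in G]) = (0 < x) && (x.-1 \in G).
Proof.
apply/imfsetP/andP => /= [[y yG ->] // | [x0 xG]].
by exists x.-1 => //; rewrite prednK.
Qed.

Lemma in_shift_add (n x : nat) (G : {fset nat}) :
  (x \in shift_add n G) = (x == n) || (0 < x) && (x.-1 \in G).
Proof. by rewrite in_fset1U in_succ_fset. Qed.

Lemma card_raise_max (m : nat) (G : {fset nat}) :
  m \in G -> m.+1 \notin G -> #|` raise_max m G| = #|` G|.
Proof.
move=> mG SmG; rewrite cardfsU1 in_fsetD1 (negPf SmG) andbF /=.
by rewrite (cardfsD1 m G) mG.
Qed.

Lemma card_shift_add (n : nat) (G : {fset nat}) :
  n.-1 \notin G -> #|` shift_add n G| = #|` G|.+1.
Proof.
move=> nG; rewrite cardfsU1 in_succ_fset (negPf nG) andbF /=.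
by rewrite card_imfset //; apply: succn_inj.
Qed.

(** The map forgets only whether [m] and [m.+1] belonged to the set; both are known when the maximum
    is [m]. *)
Lemma raise_max_inj (k m : nat) :
  {in isolated_schreier_sets k m &, injective (raise_max m)}.
Proof.
move=> G H /isolated_schreier_setsP[mG Gm _ _] /isolated_schreier_setsP[mH Hm _ _].
move=> /fsetP GH; apply/fsetP => x; have := GH x; rewrite !in_raise_max.
have [-> | _] := eqVneq x m; first by rewrite mG mH.
have [-> _ | //] := eqVneq x m.+1.
by apply/idP/idP => [/Gm | /Hm]; lia.
Qed.

(** The map forgets only membership of [n.-1], which lies above the maximum [m]. *)
Lemma shift_add_inj (k m n : nat) : m.+1 < n ->
  {in isolated_schreier_sets k m &, injective (shift_add n)}.
Proof.
move=> mn G H /isolated_schreier_setsP[_ Gm _ _] /isolated_schreier_setsP[_ Hm _ _].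
move=> /fsetP GH; apply/fsetP => x; have := GH x.+1; rewrite !in_shift_add /=.
have [xn _ | //] := eqVneq x.+1 n.
by apply/idP/idP => [/Gm | /Hm]; lia.
Qed.

(** Elements below [m.+1] in an isolated set are at most [m - k]; the gap up to [m] is still wide
    enough exactly when [m - k] itself is absent. If [m <= k], truncation makes [m - k] equal to 0,
    which is never in [F]. *)
Lemma raise_maxP (k m : nat) (F : {fset nat}) : 0 < m ->
  reflect (exists2 G, G \in isolated_schreier_sets k m & F = raise_max m G)
          ((F \in isolated_schreier_sets k m.+1) && (m - k \notin F)).
Proof.
move=> m0; apply: (iffP andP) => [[/isolated_schreier_setsP[nF Fn Fs Fi] mkF] | [G]].
  have xmk x : x \in F -> x != m - k by apply: contraTneq => ->.
  (* The gap below [m.+1] excludes [m] when [k > 0]; when [k = 0], [m] is the excluded element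
     [m - k]. *)
  have mF : m \notin F.
    by apply/negP => mF; have := Fi _ _ mF nF; have := xmk _ mF; lia.
  pose G : {fset nat} := m |` (F `\ m.+1).
  have inG (x : nat) : (x \in G) = (x == m) || (x != m.+1) && (x \in F).
    by rewrite in_fset1U in_fsetD1.
  have FG : F = raise_max m G.
    apply/fsetP => x; rewrite in_raise_max inG.
    have [-> // | _] := eqVneq x m.+1.
    by have [-> | //] := eqVneq x m; apply/negbTE.
  have mG : m \in G by rewrite inG eqxx.
  have cF : #|` F| = #|` G|.
    by rewrite [in LHS]FG card_raise_max // inG eqxx orbF; lia.
  exists G => //; apply/isolated_schreier_setsP; split=> //.
  - move=> x; rewrite inG => /predU1P[-> | /andP[xm /Fn]]; lia.
  - move=> x; rewrite inG -cF => /predU1P[-> | /andP[_ /Fs //]].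
    (* If [F] is not a singleton, its least element is at most [m]. *)
    have [/eqP F0 | /fset0Pn[y]] := boolP (F `\ m.+1 == fset0).
      by rewrite (cardfsD1 m.+1) nF F0 cardfs0.
    rewrite in_fsetD1 => /andP[ym yF].
    by have := Fs _ yF; have := Fn _ yF; lia.
  - move=> x y; rewrite !inG.
    move=> /predU1P[-> | /andP[xm xF]] /predU1P[-> | /andP[ym yF]].
    + lia.
    + have := Fn _ yF; lia.
    + have := Fi _ _ xF nF; have := xmk _ xF; lia.
    + exact: Fi.
move=> /isolated_schreier_setsP[mG Gm Gs Gi] ->.
have cG : #|` raise_max m G| = #|` G|.
  by apply: card_raise_max => //; apply/negP => /Gm; lia.
have Gsm := Gs _ mG.
split; last first.
  rewrite in_raise_max; apply/norP; split; first by lia.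
  apply/negP => /andP[mk mkG].
  have := Gm _ mkG; have := Gi _ _ mkG mG; lia.
apply/isolated_schreier_setsP; split.
- by rewrite in_raise_max eqxx.
- by move=> x; rewrite in_raise_max => /predU1P[-> | /andP[_ /Gm]]; lia.
- by move=> x; rewrite in_raise_max cG => /predU1P[-> | /andP[_ /Gs]]; lia.
- move=> x y; rewrite !in_raise_max.
  move=> /predU1P[-> | /andP[xm xG]] /predU1P[-> | /andP[ym yG]].
  + lia.
  + have := Gm _ yG; lia.
  + have := Gm _ xG; have := Gi _ _ xG mG; lia.
  + exact: Gi.
Qed.

(** Shifting up by one raises the least element by one, which pays for the added element. The old
    maximum lands on [m.+1], the highest place that the gap below [m + k + 2] allows. *)
Lemma shift_addP (k m : nat) (F : {fset nat}) : 0 < m ->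
  reflect (exists2 G, G \in isolated_schreier_sets k m
                    & F = shift_add (m + k + 2) G)
          ((F \in isolated_schreier_sets k (m + k + 2)) && (m.+1 \in F)).
Proof.
move=> m0; apply: (iffP andP) => [[/isolated_schreier_setsP[nF Fn Fs Fi] mF] | [G]].
  pose G : {fset nat} := [fset x.-1 | x in F `\ (m + k + 2)].
  (* By the Schreier condition all elements of [F] are then at least 2, so their predecessors are
     exact and positive. *)
  have F2 : 1 < #|` F|.
    have : #|` [fset m.+1; m + k + 2]| <= #|` F|.
      by apply/fsubset_leq_card/fsubsetP => y; rewrite in_fset2 => /orP[] /eqP ->.
    rewrite cardfs2; lia.
  have inG (x : nat) : (x \in G) = (x.+1 != m + k + 2) && (x.+1 \in F).
    rewrite -in_fsetD1; apply/imfsetP/idP => /= [[y yF ->] | xF]; last by exists x.+1.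
    by move: (yF); rewrite in_fsetD1 => /andP[_ /Fs yF']; rewrite prednK //; lia.
  have FG : F = shift_add (m + k + 2) G.
    apply/fsetP => x; rewrite in_shift_add inG.
    have [-> // | xn] := eqVneq x (m + k + 2).
    case: x xn => [|x] /= xn; last by rewrite xn.
    by apply/negP => /Fs; lia.
  have cF : #|` F| = #|` G|.+1.
    rewrite [in LHS]FG card_shift_add // inG prednK ?eqxx //; lia.
  exists G => //; apply/isolated_schreier_setsP; split.
  - by rewrite inG mF andbT; lia.
  - move=> x; rewrite inG => /andP[xn xF].
    have := Fs _ xF; have := Fn _ xF; have := Fi _ _ xF nF; lia.
  - by move=> x; rewrite inG => /andP[_ /Fs]; rewrite cF.
  - move=> x y; rewrite !inG => /andP[_ xF] /andP[_ yF].
    have := Fi _ _ xF yF; lia.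
move=> /isolated_schreier_setsP[mG Gm Gs Gi] ->; split; last first.
  by rewrite in_shift_add /= mG orbT.
have cG : #|` shift_add (m + k + 2) G| = #|` G|.+1.
  by apply: card_shift_add; apply/negP => /Gm; lia.
have Gsm := Gs _ mG.
apply/isolated_schreier_setsP; split.
- by rewrite in_shift_add eqxx.
- by move=> x; rewrite in_shift_add => /predU1P[-> | /andP[x0 /Gm]]; lia.
- move=> x; rewrite in_shift_add cG => /predU1P[-> | /andP[x0 /Gs]]; lia.
- move=> x y; rewrite !in_shift_add.
  move=> /predU1P[-> | /andP[x0 xG]] /predU1P[-> | /andP[y0 yG]].
  + lia.
  + have := Gm _ yG; lia.
  + have := Gm _ xG; lia.
  + have := Gi _ _ xG yG; lia.
Qed.

Theorem theorem1p4 (k : nat) (hk : 1 <= k) :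
  (forall n : nat, 1 <= n <= k + 2 -> #|` isolated_schreier_sets k n| = 1) /\
  (forall n : nat, k + 3 <= n ->
     #|` isolated_schreier_sets k n| =
     #|` isolated_schreier_sets k (n - 1)| +
     #|` isolated_schreier_sets k (n - k - 2)|).
Proof.
split=> [n nk | n kn]; first by rewrite isolated_schreier_sets_small ?cardfs1.
(* This turns the truncated subtractions into sums; the deciding element [n - k - 1] becomes
   [m.+1]. *)
have [m m0 ->] : exists2 m, 0 < m & n = m + k + 2 by exists (n - k - 2); lia.
have -> : m + k + 2 - 1 = m + k + 1 by lia.
have -> : m + k + 2 - k - 2 = m by lia.
have mk0 : 0 < m + k + 1 by lia.
have := raise_maxP k _ _ mk0; have := shift_addP k _ _ m0.
have -> : (m + k + 1).+1 = m + k + 2 by lia.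
have -> : m + k + 1 - k = m.+1 by lia.
move: (isolated_schreier_sets k (m + k + 2)) => I shiftP raiseP.
(* Both reflection lemmas now test the same element [m.+1], so their classes partition [I]; [addnC]
   puts the class without it first. *)
rewrite -(cardfsID [fset F in I | m.+1 \in F] I) addnC.
have -> : I `\` [fset F in I | m.+1 \in F]
        = [fset raise_max (m + k + 1) G | G in isolated_schreier_sets k (m + k + 1)].
  apply/fsetP => F; rewrite !inE /= negb_and andb_orl andNb /= andbC.
  by apply/raiseP/imfsetP.
have -> : I `&` [fset F in I | m.+1 \in F]
        = [fset shift_add (m + k + 2) G | G in isolated_schreier_sets k m].
  apply/fsetP => F; rewrite !inE /= andbA andbb.
  by apply/shiftP/imfsetP.
rewrite !card_in_imfset //; last exact: raise_max_inj.
by apply: shift_add_inj; lia.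
Qed.
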